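(* Consider the sender-receiver game $\Gamma$ with data $(K,p,M,X,(U^k)_{k\in K},(V^k)_{k\in K},(u_0^k)_{k\in K})$ described in the context. Assume that the receiver's utility function does not depend on the sender's type, i.e., that there exists a continuous function $V:X\to\mathbb{R}$ such that $V^k=V$ for every $k\in K$. Then $\Gamma$ has a partitional equilibrium.
   Context: Data of the game $\Gamma$. $K$ is a nonempty finite set of types; $p\in\Delta(K)$ is a prior probability with $p^k>0$ for every $k\in K$; $M$ is a finite set of messages with $|M|\ge|K|$; $X$ is a compact (topological) space of decisions; for every $k\in K$, $U^k:X\to\mathbb{R}$ (sender, player 1) and $V^k:X\to\mathbb{R}$ (receiver, player 2) are continuous utility functions and $u_0^k\in\mathbb{R}$ is the sender's outside option. It is assumed that for every $k\in K$ there exists $x\in X$ with $U^k(x)\ge u_0^k$. ($\Delta(S)$ denotes the set of probability distributions on a finite set $S$.) Interpretation: a type $k$ is drawn from $p$ and told to the sender, who sends a message $m\in M$; the receiver then proposes $x\in X$; if the sender accepts, payoffs are $U^k(x),V^k(x)$; if he rejects (exit), he gets $u_0^k$ and the receiver gets $-\infty$. The sender of type $k$ accepts $x$ if and only if $U^k(x)\ge u_0^k$. The receiver's equilibrium expected utility is required to be finite. For $L\subseteq K$ let $X(L)=\{x\in X: U^k(x)\ge u_0^k \ \forall k\in L\}$. A strategy of the sender is a map $\sigma:K\to\Delta(M)$, written $\sigma(m\mid k)$; a strategy of the receiver is a map $\tau:M\to X$. Put $P_\sigma(m)=\sum_{k}p^k\sigma(m\mid k)$ and, if $P_\sigma(m)>0$,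 $p_m^k(\sigma)=p^k\sigma(m\mid k)/P_\sigma(m)$, $p_m(\sigma)=(p_m^k(\sigma))_{k\in K}\in\Delta(K)$, with support $\mathrm{supp}\,p_m(\sigma)\subseteq K$. An equilibrium of $\Gamma$ is a pair $(\sigma,\tau)$ such that (1) (incentive compatibility) $U^k(\tau(m))\ge U^k(\tau(m'))$ for all $k\in K$, all $m\in M$ with $\sigma(m\mid k)>0$ and all $m'\in M$; (2) (constrained optimization, no exit) for every $m\in M$ with $P_\sigma(m)>0$, $X(\mathrm{supp}\,p_m(\sigma))\ne\emptyset$ and $\tau(m)\in\arg\max_{x\in X(\mathrm{supp}\,p_m(\sigma))}\sum_{k}p_m^k(\sigma)V^k(x)$. An equilibrium is partitional if $\sigma$ is pure, i.e., for every $k\in K$, $\sigma(\cdot\mid k)$ is concentrated on a single message. *)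

(* Defs.v *)
From mathcomp Require Import all_boot all_order all_algebra.
From mathcomp Require Import all_classical all_reals all_analysis.

Set Implicit Arguments.
Unset Strict Implicit.
Unset Printing Implicit Defensive.

Import Order.TTheory GRing.Theory Num.Theory.
Import numFieldNormedType.Exports.
Local Open Scope classical_set_scope.
Local Open Scope ring_scope.

Record distr (R : realType) (S : finType) := Distr {
  prob :> S -> R ;
  prob_ge0 : forall s, 0 <= prob s ;
  prob_sum1 : \sum_(s : S) prob s = 1 }.

(* The topology on X is not assumed to be Hausdorff. *)
Record game (R : realType) (K M : finType) (X : topologicalType) := Game {
  prior : distr R K ;
  sender_utility : K -> X -> R ;
  receiver_utility : K -> X -> R ;
  outside_option : K -> R ;
  types_nonempty : (0 < #|K|)%N ;
  prior_gt0 : forall k, 0 < prior k ;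
  enough_messages : (#|K| <= #|M|)%N ;
  decisions_compact : compact [set: X] ;
  sender_utility_continuous : forall k, continuous (sender_utility k) ;
  receiver_utility_continuous : forall k, continuous (receiver_utility k) ;
  participation : forall k, exists x, outside_option k <= sender_utility k x }.

Section Equilibrium.
Variables (R : realType) (K M : finType) (X : topologicalType).
Variable G : game R K M X.
Implicit Types (sigma : K -> distr R M) (tau : M -> X) (L : {set K}).

Definition acceptable L : set X :=
  [set x | forall k, k \in L -> outside_option G k <= sender_utility G k x].

Definition message_prob sigma (m : M) : R :=
  \sum_(k : K) prior G k * sigma k m.

(* Meaningful only when 0 < message_prob sigma m; it is identically 0 otherwise. *)
Definition posterior sigma (m : M) (k : K) : R :=
  prior G k * sigma k m / message_prob sigma m.

Definition posterior_supp sigma (m : M) : {set K} :=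
  [set k | 0 < posterior sigma m k]%SET.

Definition receiver_payoff sigma (m : M) (x : X) : R :=
  \sum_(k : K) posterior sigma m k * receiver_utility G k x.

Definition argmax (f : X -> R) (A : set X) : set X :=
  [set x | A x /\ forall y, A y -> f y <= f x].

Definition incentive_compatible sigma tau : Prop :=
  forall k m, 0 < sigma k m ->
  forall m', sender_utility G k (tau m') <= sender_utility G k (tau m).

Definition constrained_optimal sigma tau : Prop :=
  forall m, 0 < message_prob sigma m ->
    acceptable (posterior_supp sigma m) !=set0 /\
    argmax (receiver_payoff sigma m) (acceptable (posterior_supp sigma m))
      (tau m).

Definition equilibrium sigma tau : Prop :=
  incentive_compatible sigma tau /\ constrained_optimal sigma tau.

Definition pure sigma : Prop := forall k, exists m, sigma k m = 1.

Definition partitional_equilibrium sigma tau : Prop :=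
  equilibrium sigma tau /\ pure sigma.

End Equilibrium.

(* Main.v *)
Require Import Defs.
From mathcomp Require Import all_boot all_order all_algebra.
From mathcomp Require Import all_classical all_reals all_analysis.

(** The receiver does as well as if he could commit to a menu.  A menu is a map
    [tau : M -> X]; call it covering when every type finds in it some decision
    that he accepts.  Since [#|K| <= #|M|], listing one acceptable decision per
    type gives a covering menu.  Covering is a closed condition on the compact
    space [X ^ M], so some covering menu [tau] maximizes the total utility
    [\sum_m V (tau m)] over all covering menus.

    Let each type pick his favourite item [tau (f k)] of this menu.  Incentive
    compatibility is then automatic, and the favourite item of [k] is acceptable
    to [k] because some item is.  It remains to see that the receiver cannot do
    better after a message [m].  As his utility is independent of the type, the
    posterior after [m] matters only through its support, the set of the types
    that pick [m].  If some [y], acceptable to all of them, had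
    [V (tau m) < V y], then replacing [tau m] by [y] would keep the menu
    covering ([y] serves the types that picked [m], the others keep their item)
    and increase the total utility, against the choice of [tau].

    The unweighted total serves because an improvement after [m] leaves the
    other items alone.  A total weighted by the probabilities of the messages
    would depend on [f], which is only chosen once [tau] is known. *)

Set Implicit Arguments.
Unset Strict Implicit.
Unset Printing Implicit Defensive.

Import Order.TTheory GRing.Theory Num.Theory.
Import numFieldNormedType.Exports.
Local Open Scope classical_set_scope.
Local Open Scope ring_scope.

Definition covering_menu (R : realType) (K M : finType) (X : Type)
    (U : K -> X -> R) (u0 : K -> R) (tau : M -> X) : Prop :=
  forall k, exists m, u0 k <= U k (tau m).

Lemma covering_menu_exists (R : realType) (K M : finType) (X : Type)
    (U : K -> X -> R) (u0 : K -> R) :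
  (0 < #|K| <= #|M|)%N -> (forall k, exists x, u0 k <= U k x) ->
  exists tau : M -> X, covering_menu U u0 tau.
Proof.
case/andP=> /card_gt0P[k0 _] leKM /choice[x xP].
pose type_of (m : M) : K := nth k0 (enum K) (enum_rank m).
exists (x \o type_of) => k.
exists (enum_val (widen_ord leKM (enum_rank k))).
by rewrite /= /type_of enum_valK /= nth_enum_rank.
Qed.

Lemma closed_covering_menu (R : realType) (K M : finType) (X : topologicalType)
    (U : K -> X -> R) (u0 : K -> R) :
  (forall k, continuous (U k)) ->
  closed [set tau : prod_topology (fun _ : M => X) | covering_menu U u0 tau].
Proof.
move=> Uc.
have -> : [set tau : prod_topology (fun _ : M => X) | covering_menu U u0 tau] =
    \bigcap_(k in [set: K]) \bigcup_(m in [set: M])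
      (U k \o @proj M (fun=> X) m) @^-1` [set r | u0 k <= r].
  apply/seteqP; split=> [tau tauP k _|tau tauP k].
    by have [m le_m] := tauP k; exists m.
  by have [m _ le_m] := tauP k I; exists m.
apply: closed_bigI => k _; apply: closed_bigcup; first exact: finite_finset.
move=> m _; apply: preimage_closed; last exact: closed_ge.
by move=> tau _; apply: continuous_comp; [exact: proj_continuous|exact: Uc].
Qed.

Lemma optimal_covering_menu (R : realType) (K M : finType)
    (X : topologicalType) (U : K -> X -> R) (u0 : K -> R) (V : X -> R) :
  (0 < #|K| <= #|M|)%N -> compact [set: X] ->
  (forall k, continuous (U k)) -> continuous V ->
  (forall k, exists x, u0 k <= U k x) ->
  exists2 tau : M -> X, covering_menu U u0 tau &
    forall tau' : M -> X, covering_menu U u0 tau' ->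
      \sum_m V (tau' m) <= \sum_m V (tau m).
Proof.
move=> leKM cX Uc Vc acc.
pose C := [set tau : prod_topology (fun _ : M => X) | covering_menu U u0 tau].
pose W (tau : prod_topology (fun _ : M => X)) := \sum_m V (tau m).
have C0 : C !=set0.
  by have [tau tauP] := covering_menu_exists leKM acc; exists tau.
have cC : compact C.
  have cXM : compact [set tau : prod_topology (fun _ : M => X) |
      forall m, [set: X] (tau m)].
    exact: (@tychonoff M (fun=> X) (fun=> setT)).
  exact: subclosed_compact (closed_covering_menu Uc) cXM _.
have cW : continuous W.
  apply: continuous_big; first exact: add_continuous.
  move=> m _ tau; apply: (continuous_comp (g := V)); last exact: Vc.
  exact: (@proj_continuous M (fun=> X) m).
have [tau] := compact_EVT_max C0 cC (continuous_subspaceT cW).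
rewrite inE => tauP tau_max; exists tau => // tau' tau'P.
by apply: tau_max; rewrite inE.
Qed.

(** One improved item suffices to contradict optimality: [y] is swapped in for
    [tau m], which uncovers no type. *)
Lemma optimal_menu_best_reply (R : realType) (K M : finType) (X : Type)
    (U : K -> X -> R) (u0 : K -> R) (V : X -> R) (tau : M -> X) (f : K -> M) :
  (forall tau' : M -> X, covering_menu U u0 tau' ->
    \sum_m V (tau' m) <= \sum_m V (tau m)) ->
  (forall k, u0 k <= U k (tau (f k))) ->
  forall m y, (forall k, f k = m -> u0 k <= U k y) -> V y <= V (tau m).
Proof.
move=> tau_max f_acc m y y_acc.
pose tau' m' := if m' == m then y else tau m'.
have /tau_max : covering_menu U u0 tau'.
  move=> k; exists (f k); rewrite /tau'.
  by case: eqP => [/y_acc|_].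
rewrite (bigD1 m) // [leRHS](bigD1 m) //= {1}/tau' eqxx.
rewrite [X in _ + X <= _](eq_bigr (fun i => V (tau i))) ?lerD2r //.
by move=> i /negPf i_m; rewrite /tau' i_m.
Qed.

Lemma favourite_item (R : realType) (K M : finType) (X : Type)
    (U : K -> X -> R) (tau : M -> X) (m0 : M) :
  exists f : K -> M, forall k m, U k (tau m) <= U k (tau (f k)).
Proof.
exists (fun k => [arg max_(m > m0) U k (tau m)]%O) => k m.
by case: arg_maxP => // i _; apply.
Qed.

Lemma pure_strategy_ge0 (R : realType) (M : finType) (m0 m : M) :
  0 <= (m == m0)%:R :> R.
Proof. exact: ler0n. Qed.

Lemma pure_strategy_sum1 (R : realType) (M : finType) (m0 : M) :
  \sum_m (m == m0)%:R = 1 :> R.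
Proof. by rewrite (bigD1 m0) //= eqxx big1 ?addr0 // => i /negPf ->. Qed.

Definition pure_strategy (R : realType) (K M : finType) (f : K -> M) (k : K) :
    distr R M :=
  Distr (pure_strategy_ge0 R (f k)) (pure_strategy_sum1 R (f k)).

Lemma pure_strategy_gt0 (R : realType) (K M : finType) (f : K -> M) k m :
  (0 < pure_strategy R f k m) = (m == f k).
Proof. by rewrite /= ltr0n lt0b. Qed.

Lemma posterior_suppE (R : realType) (K M : finType) (X : topologicalType)
    (G : game R K M X) (sigma : K -> distr R M) (m : M) (k : K) :
  0 < message_prob G sigma m ->
  (k \in posterior_supp G sigma m) = (0 < sigma k m).
Proof.
move=> Pm; rewrite inE /posterior pmulr_lgt0 ?invr_gt0 //.
by rewrite pmulr_rgt0 // prior_gt0.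
Qed.

Lemma receiver_payoff_const (R : realType) (K M : finType)
    (X : topologicalType) (G : game R K M X) (V : X -> R)
    (sigma : K -> distr R M) (m : M) (x : X) :
  (forall k, receiver_utility G k = V) -> 0 < message_prob G sigma m ->
  receiver_payoff G sigma m x = V x.
Proof.
move=> GV Pm; rewrite /receiver_payoff.
under eq_bigr do rewrite GV.
by rewrite -mulr_suml /posterior -mulr_suml divff ?mul1r // gt_eqF.
Qed.

Theorem theorem8 (R : realType) (K M : finType) (X : topologicalType)
    (G : game R K M X)
    (type_independent : exists V : X -> R,
       continuous V /\ forall k : K, receiver_utility G k = V) :
  exists (sigma : K -> distr R M) (tau : M -> X),
    partitional_equilibrium G sigma tau.
Proof.
have [V [Vc GV]] := type_independent.
have K0 := types_nonempty G; have leKM := enough_messages G.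
have [tau tau_cov tau_max] :=
  @optimal_covering_menu R K M X _ _ V (introT andP (conj K0 leKM))
    (decisions_compact G) (@sender_utility_continuous _ _ _ _ G) Vc
    (participation G).
have /card_gt0P[m0 _] := leq_trans K0 leKM.
have [f f_fav] := favourite_item (sender_utility G) tau m0.
have f_acc k : outside_option G k <= sender_utility G k (tau (f k)).
  by have [m le_m] := tau_cov k; exact: le_trans le_m (f_fav k m).
exists (pure_strategy R f), tau; split; last first.
  by move=> k; exists (f k); rewrite /= eqxx.
split=> [k m|m Pm].
  by rewrite pure_strategy_gt0 => /eqP -> m'; exact: f_fav.
have supp k : (k \in posterior_supp G (pure_strategy R f) m) = (m == f k).
  by rewrite posterior_suppE // pure_strategy_gt0.
have tau_acc : acceptable G (posterior_supp G (pure_strategy R f) m) (tau m).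
  by move=> k; rewrite supp => /eqP ->; exact: f_acc.
split; first by exists (tau m).
split=> // y y_acc; rewrite !(receiver_payoff_const _ GV Pm).
apply: (optimal_menu_best_reply tau_max f_acc) => k fk.
by apply: y_acc; rewrite supp fk.
Qed.
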